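(* For every integer $n\ge 0$, as formal power series in $x$, $$\sum_{k\ge 0}a_{n,k}x^k=\frac{x\,I_n(x)}{(1-x)^{n+1}},$$ where $I_n(x)=\sum_{\sigma\in\mathscr{I}_n}x^{d(\sigma)}$.
   Context: $a_{n,k}$ is the number of semistandard Young tableaux with $n$ cells whose entries lie in $\{1,\dots,k\}$ (not necessarily all used), where a semistandard Young tableau is a filling of a Ferrers diagram strictly increasing along rows and weakly increasing down columns. $\mathscr{I}_n$ is the set of involutions of $\{1,\dots,n\}$; for $\sigma\in\mathscr{I}_n$, $d(\sigma)$ is the number of $i\in\{1,\dots,n-1\}$ with $\sigma(i)>\sigma(i+1)$.
   Formalization: The value a_{0,0} is taken to be 0 (the empty tableau is not counted over the empty alphabet), since with a_{0,0}=1 the identity fails at n=0 (1/(1-x) versus x/(1-x)); all other a_{n,k} are the plain counts. *)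

(* Defs.v *)
From mathcomp Require Import all_boot all_order all_algebra all_fingroup.

Set Implicit Arguments.
Unset Strict Implicit.
Unset Printing Implicit Defensive.

Import GRing.Theory.
Local Open Scope ring_scope.

(** * Formal power series, as coefficient sequences compared with [=1] *)

Section FormalPowerSeries.
Variable R : unitRingType.
Implicit Types f g : nat -> R.

Definition fps_of_poly (p : {poly R}) : nat -> R := fun i => p`_i.

Definition fps_mul f g : nat -> R :=
  fun n => \sum_(i < n.+1) f i * g (n - i)%N.

(* [fps_inv_seq f n] lists the coefficients b_0, ..., b_n of 1/f, computed by
   b_0 = 1/f_0 and b_m = - (1/f_0) * (f_1 b_(m-1) + ... + f_m b_0). *)
Fixpoint fps_inv_seq f (n : nat) : seq R :=
  if n is m.+1 then
    let b := fps_inv_seq f m in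
    rcons b (- ((f 0%N)^-1 * \sum_(i < m.+1) f i.+1 * b`_(m - i)))
  else [:: (f 0%N)^-1].

(* Meaningful only when [f 0] is a unit, see [fps_mulfV]. *)
Definition fps_inv f : nat -> R := fun n => (fps_inv_seq f n)`_n.

Definition fps_div f g := fps_mul f (fps_inv g).

Lemma size_fps_inv_seq f n : size (fps_inv_seq f n) = n.+1.
Proof. by elim: n => //= n IHn; rewrite size_rcons IHn. Qed.

Lemma nth_fps_inv_seq f n i :
  (i <= n)%N -> (fps_inv_seq f n)`_i = fps_inv f i.
Proof.
elim: n => [|n IHn]; first by rewrite leqn0 => /eqP->.
rewrite leq_eqVlt => /predU1P[-> // | lt_in].
by rewrite /= nth_rcons size_fps_inv_seq lt_in IHn.
Qed.

Lemma fps_mulfV f : f 0%N \is a GRing.unit ->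
  fps_mul f (fps_inv f) =1 fps_of_poly 1.
Proof.
move=> Uf0 [|n]; rewrite /fps_mul /fps_of_poly coef1.
  by rewrite big_ord1 /fps_inv /= divrr.
rewrite big_ord_recl subn0 {1}/fps_inv /= nth_rcons size_fps_inv_seq.
rewrite ltnn eqxx mulrN mulrA divrr // mul1r addrC; apply/eqP.
rewrite subr_eq0; apply/eqP/eq_bigr => i _.
by rewrite nth_fps_inv_seq ?leq_subr // /bump add1n subSS.
Qed.

End FormalPowerSeries.

(** * Semistandard Young tableaux *)

Section Tableaux.
Variables n k : nat.

(* A Ferrers diagram with n cells fits in the n x n square; a cell is a pair
   (row, column), and D is the diagram of the partition lam_0 >= lam_1 >= ... *)
Definition is_ferrers (D : {set 'I_n * 'I_n}) : bool :=
  [exists lam : {ffun 'I_n -> 'I_n.+1},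
     [forall i : 'I_n, forall j : 'I_n, (i <= j)%N ==> (lam j <= lam i)%N]
     && (D == [set c : 'I_n * 'I_n | (c.2 < lam c.1)%N])].

(* [T c] is [None] outside the diagram; the entry v in {1, ..., k} is encoded
   as the element v - 1 of ['I_k]. *)
Definition filling := {ffun 'I_n * 'I_n -> option 'I_k}.

Definition shape (T : filling) : {set 'I_n * 'I_n} := [set c | T c != None].

Definition entry_rel (r : rel nat) (u v : option 'I_k) : bool :=
  if (u, v) is (Some x, Some y) then r x y else true.

Definition row_strict (T : filling) : bool :=
  [forall i : 'I_n, forall j : 'I_n, forall j' : 'I_n,
     (j < j')%N ==> entry_rel ltn (T (i, j)) (T (i, j'))].

Definition col_weak (T : filling) : bool :=
  [forall j : 'I_n, forall i : 'I_n, forall i' : 'I_n,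
     (i < i')%N ==> entry_rel leq (T (i, j)) (T (i', j))].

Definition is_ssyt (T : filling) : bool :=
  [&& is_ferrers (shape T), #|shape T| == n, row_strict T & col_weak T].

Definition num_ssyt : nat := #|[set T : filling | is_ssyt T]|.

(* The empty tableau is not counted over the empty alphabet, so a_{0,0} = 0.
   The identity with x I_n(x) on the right forces this value at n = 0, since
   that right-hand side has no constant term; counting the empty tableau would
   give 1. For every other (n, k), this is the number of tableaux. *)
Definition a_ : nat := if (n == 0%N) && (k == 0%N) then 0%N else num_ssyt.

End Tableaux.

(** * Involutions *)

Definition involutions (n : nat) : {set 'S_n} :=
  [set s : 'S_n | [forall i : 'I_n, s (s i) == i]].

Definition descents (n : nat) (s : 'S_n) : nat :=
  #|[set i : 'I_n | [exists j : 'I_n, (j == i.+1 :> nat) && (s j < s i)%N]]|.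

Definition I_poly (n : nat) : {poly int} :=
  \sum_(s in involutions n) 'X^(descents s).

(* Main.v *)
Require Import Defs.
From mathcomp Require Import all_boot all_order all_algebra all_fingroup.
From mathcomp Require Import zify.

(** Both sides count symmetric k x k matrices of natural numbers with entry
    sum n.

    A tableau is a chain of k partitions starting at the empty one, the j-th
    being the column lengths of the part filled with the j smallest letters;
    consecutive partitions interlace. Let U and D send a partition to the sum
    of those interlacing it from above and from below, weighted by t to the
    change of size, and let phi send every partition to 1. One toggle
    bijection gives phi U = (1 - t)^-1 phi D and D U = (1 - t^2)^-1 U D, so the
    last step of a chain can be bent down and moved to the beginning, where it
    disappears. Hence the generating function of tableaux in n is the product
    over j < k of (1 - t)^-1 (1 - t^2)^-j, as for symmetric matrices.

    A symmetric matrix A is a multiset of pairs (i, j) stable under exchange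
    of coordinates. Listing it in lexicographic order, the exchange becomes an
    involution s of the positions and the first coordinates become a weakly
    increasing sequence in {0, ..., k-1}, strictly increasing at the descents
    of s. For a given s there are C(n - 1 - d(s) + k, n) such sequences,
    which is the coefficient of x^k in x^(d(s)+1) / (1-x)^(n+1). *)

Set Implicit Arguments.
Unset Strict Implicit.
Unset Printing Implicit Defensive.

Import GRing.Theory.

Lemma card_ord_ltn n m : m <= n -> #|[set i : 'I_n | i < m]| = m.
Proof.
move=> le_mn; rewrite -sum1_card -[RHS]card_ord -sum1_card.
rewrite -(big_ord_narrow le_mn (F := fun=> 1) (op := addn)).
by apply: eq_bigl => i; rewrite inE.
Qed.

(** * Interlacing partitions *)

Section Interlacing.
Variables K N : nat.

Notation part := {ffun 'I_K -> 'I_N.+1}.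
Implicit Types (a b k l m v : part) (f : nat -> nat).

(* The sequence of parts, continued by zeros. *)
Definition ev l (i : nat) : nat := if insub i is Some j then l j else 0.

Definition mkpart f : part := [ffun i : 'I_K => inord (f i)].

Definition wt l : nat := \sum_(i < K) ev l i.

(** That is, [b / a] is a horizontal strip. The relation forces [a] and [b] to be weakly decreasing,
    so [part] does not impose it. *)
Definition interl a b : bool :=
  [forall i : 'I_K, ev b i.+1 <= ev a i <= ev b i].

Lemma ev_ord l (i : 'I_K) : ev l i = l i.
Proof. by rewrite /ev valK. Qed.

Lemma ev_oversize l i : K <= i -> ev l i = 0.
Proof. by move=> leKi; rewrite /ev insubF // ltnNge leKi. Qed.

Lemma ev_leN l i : ev l i <= N.
Proof. by rewrite /ev; case: insub => // j; rewrite -ltnS. Qed.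

Lemma ev_mkpart f : (forall i, f i <= N) -> (forall i, K <= i -> f i = 0) ->
  ev (mkpart f) =1 f.
Proof.
move=> fN fK i; case: (ltnP i K) => [lt_iK | leKi]; last first.
  by rewrite ev_oversize ?fK.
by rewrite -[i]/(val (Ordinal lt_iK)) ev_ord ffunE inordK ?ltnS.
Qed.

Lemma ev_inj l m : ev l =1 ev m -> l = m.
Proof. by move=> eq_lm; apply/ffunP=> i; apply/val_inj;
  rewrite /= -!ev_ord. Qed.

Lemma interlP a b :
  reflect (forall i, ev b i.+1 <= ev a i <= ev b i) (interl a b).
Proof.
apply: (iffP forallP) => [ab i | ab i]; last exact: ab.
case: (ltnP i K) => [lt_iK | leKi]; first exact: (ab (Ordinal lt_iK)).
by rewrite !ev_oversize // ltnW.
Qed.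

Lemma ev_le_wt l i : ev l i <= wt l.
Proof.
case: (ltnP i K) => [lt_iK | leKi]; last by rewrite ev_oversize.
by rewrite /wt (bigD1 (Ordinal lt_iK)) //= leq_addr.
Qed.

Lemma interl_wt a b : interl a b -> wt a <= wt b.
Proof. by move=> /interlP ab; apply: leq_sum => i _; case/andP: (ab i). Qed.

Lemma wt_recl l : 0 < K -> wt l = ev l 0 + \sum_(i < K.-1) ev l i.+1.
Proof. by rewrite /wt; case: (K) => // K' _; rewrite big_ord_recl. Qed.

Lemma wt_recr l : 0 < K -> ev l K.-1 = 0 -> wt l = \sum_(i < K.-1) ev l i.
Proof.
rewrite /wt; case: (K) (ev l) => // K' f _ f0.
by rewrite big_ord_recr /= f0 addn0.
Qed.

Definition incr0 l := mkpart (fun i => ev l i + (i == 0)).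
Definition decr0 l := mkpart (fun i => ev l i - (i == 0)).

Lemma ev_incr0 l : 0 < K -> ev l 0 < N -> ev (incr0 l) =1 fun i =>
  ev l i + (i == 0).
Proof.
move=> K0 l0; apply: ev_mkpart => [i | i leKi]; last by rewrite ev_oversize //;
  lia.
by case: i => [|i] /=; rewrite ?addn1 ?addn0 ?ev_leN.
Qed.

Lemma ev_decr0 l : ev (decr0 l) =1 fun i => ev l i - (i == 0).
Proof.
apply: ev_mkpart => [i | i leKi]; last by rewrite ev_oversize.
by have := ev_leN l i; lia.
Qed.

(* Given m and v, the part l_(i+1) of a common upper neighbour l and the part
   k_i of a common lower neighbour k range over the same interval, from
   max(m_(i+1), v_(i+1)) to min(m_i, v_i); the toggles reflect it. Only l_0 is
   then left free, and only from above. *)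
Definition toggle_down m v l := mkpart (fun i =>
  maxn (ev m i.+1) (ev v i.+1) + minn (ev m i) (ev v i) - ev l i.+1).
Definition toggle_up m v k := mkpart (fun i =>
  if i is j.+1 then maxn (ev m i) (ev v i) + minn (ev m j) (ev v j) - ev k j
  else maxn (ev m 0) (ev v 0)).

Lemma ev_toggle_down m v l : interl m l -> interl v l ->
  ev (toggle_down m v l) =1 fun i =>
  maxn (ev m i.+1) (ev v i.+1) + minn (ev m i) (ev v i) - ev l i.+1.
Proof.
move=> /interlP ml /interlP vl; apply: ev_mkpart => [i | i leKi].
  by have := ev_leN m i; have := ml i.+1; have := vl i.+1; have := ml i;
    have := vl i; lia.
by rewrite !ev_oversize // ltnW.
Qed.

Lemma ev_toggle_up m v k : 0 < K -> ev m K.-1 = 0 -> interl k m -> interl k v ->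
  ev (toggle_up m v k) =1 fun i =>
  if i is j.+1 then maxn (ev m i) (ev v i) + minn (ev m j) (ev v j) - ev k j
  else maxn (ev m 0) (ev v 0).
Proof.
move=> K0 mK /interlP km /interlP kv; apply: ev_mkpart => [[|i] | [|i] leKi].
- by rewrite geq_max !ev_leN.
- by have := ev_leN m i; have := km i; have := kv i; lia.
- by lia.
rewrite !(ev_oversize _ leKi) // max0n add0n.
have [-> | neq_i] := eqVneq i K.-1; first by rewrite mK min0n.
by rewrite !ev_oversize //; lia.
Qed.

(** If [l_0] exceeds max(m_0, v_0), lowering it by one gives an upper neighbour of weight [s - 1];
    otherwise it equals that maximum and toggling turns [l] into [k]. The bound [s <= N] leaves room
    for raising [l_0] back, and [ev m K.-1 = 0] lets the toggled sequences fit in [K] entries. *)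
Lemma local_rule m v s : 0 < K -> ev m K.-1 = 0 -> s <= N ->
  #|[set l | [&& interl m l, interl v l & wt l == s]]| =
  #|[set l | [&& interl m l, interl v l & (wt l).+1 == s]]| +
  #|[set k | [&& interl k m, interl k v & s + wt k == wt m + wt v]]|.
Proof.
move=> K0 mK sN.
set A := [set l | _]; set B := [set l | _]; set C := [set k | _].
pose top l := ev l 0 == maxn (ev m 0) (ev v 0).
rewrite -(cardsID [set l | top l] A) addnC; congr (_ + _).
- have injb : {in B &, injective incr0}.
    move=> l l'; rewrite !inE => /and3P[_ _ /eqP ls] /and3P[_ _ /eqP ls'] eq_ll.
    apply: ev_inj => i; move: (congr1 (ev^~ i) eq_ll) => /=.
    have lN : ev l 0 < N by have := ev_le_wt l 0; lia.
    have lN' : ev l' 0 < N by have := ev_le_wt l' 0; lia.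
    by rewrite !ev_incr0 //; lia.
  rewrite -(card_in_imset injb); congr #|pred_of_set _|.
  apply/setP=> l; rewrite !inE; apply/idP/imsetP.
    case/and4P=> ntop /[dup] Iml /interlP ml /[dup] Ivl /interlP vl /eqP ls.
    have l0 : 0 < ev l 0 by have := ml 0; have := vl 0; move: ntop;
      rewrite /top; lia.
    exists (decr0 l).
      rewrite inE; apply/and3P; split.
      + apply/interlP=> i; rewrite !ev_decr0; have := ml i; have := vl i.
        by move: ntop; rewrite /top; case: i => [|i] /=; lia.
      + apply/interlP=> i; rewrite !ev_decr0; have := ml i; have := vl i.
        by move: ntop; rewrite /top; case: i => [|i] /=; lia.
      + rewrite -ls !wt_recl // !ev_decr0.
        under eq_bigr do rewrite ev_decr0 subn0.
        by apply/eqP; rewrite /=; lia.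
    apply: ev_inj => i; rewrite ev_incr0 ?ev_decr0 //;
      last by have := ev_leN l 0; lia.
    by case: i => [|i] /=; lia.
  case=> l' + ->; rewrite inE => /and3P[/interlP ml /interlP vl /eqP ls].
  have l'N : ev l' 0 < N by have := ev_le_wt l' 0; lia.
  rewrite /top !ev_incr0 //; apply/and4P; split.
  + by have := ml 0; have := vl 0; lia.
  + by apply/interlP=> i; rewrite !ev_incr0 //; have := ml i; lia.
  + by apply/interlP=> i; rewrite !ev_incr0 //; have := vl i; lia.
  rewrite -ls !wt_recl // !ev_incr0 //.
  under eq_bigr do rewrite ev_incr0 // addn0.
  by apply/eqP; rewrite /=; lia.
have injd : {in A :&: [set l | top l] &, injective (toggle_down m v)}.
  move=> l l'; rewrite !inE =>
    /andP[/and3P[ml vl _] /eqP tl] /andP[/and3P[ml' vl' _] /eqP tl'] eq_ll.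
  apply: ev_inj => i; case: i => [|i]; first by rewrite tl tl'.
  move: (congr1 (ev^~ i) eq_ll); rewrite /= !ev_toggle_down //.
  move/interlP: ml; move/interlP: vl; move/interlP: ml'; move/interlP: vl'.
  by move=> /(_ i) ? /(_ i) ? /(_ i) ? /(_ i) ?; lia.
rewrite -(card_in_imset injd); congr #|pred_of_set _|.
(* Summing the reflections pairs each maximum with the minimum of the same index; the last minimum
   is zero because [ev m K.-1 = 0]. *)
have weight l k : ev l 0 = maxn (ev m 0) (ev v 0) -> ev k K.-1 = 0 ->
    (forall i, ev l i.+1 + ev k i =
      maxn (ev m i.+1) (ev v i.+1) + minn (ev m i) (ev v i)) ->
    wt l + wt k = wt m + wt v.
  move=> l0 kK lk; rewrite wt_recl // [wt k]wt_recr // -addnA -big_split /=.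
  under eq_bigr do rewrite lk.
  rewrite big_split /= addnA l0.
  have <- : \sum_(i < K) maxn (ev m i) (ev v i) =
     maxn (ev m 0) (ev v 0) + \sum_(i < K.-1) maxn (ev m i.+1) (ev v i.+1).
    by clear -K0; case: (K) K0 (ev m) (ev v) => // K' _ fm fv;
      rewrite big_ord_recl.
  have <- : \sum_(i < K) minn (ev m i) (ev v i) =
    \sum_(i < K.-1) minn (ev m i) (ev v i).
    clear -K0 mK; case: (K) K0 (ev m) (ev v) mK => // K' _ fm fv /= mK.
    by rewrite big_ord_recr /= mK min0n addn0.
  by rewrite -!big_split; apply: eq_bigr => i _ /=; lia.
apply/setP=> k; rewrite !inE; apply/imsetP/idP.
  case=> l; rewrite !inE => /andP[/and3P[Iml Ivl /eqP ls] /eqP tl] ->.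
  have ml := interlP _ _ Iml; have vl := interlP _ _ Ivl.
  have Ed := ev_toggle_down Iml Ivl.
  apply/and3P; split.
  - by apply/interlP=> i; rewrite Ed; have := ml i; have := vl i;
    have := ml i.+1; have := vl i.+1; lia.
  - by apply/interlP=> i; rewrite Ed; have := ml i; have := vl i;
    have := ml i.+1; have := vl i.+1; lia.
  rewrite -ls; apply/eqP/weight => // [|i]; last first.
    by rewrite Ed; have := ml i; have := vl i; lia.
  by rewrite Ed prednK // !(ev_oversize _ (leqnn K)) mK min0n.
case/and3P=> Ikm Ikv /eqP ks; have km := interlP _ _ Ikm;
  have kv := interlP _ _ Ikv.
have Eu := ev_toggle_up K0 mK Ikm Ikv.
have Iml : interl m (toggle_up m v k).
  apply/interlP=> i; rewrite !Eu; have := km i; have := kv i.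
  by case: i => [|i] /=; try (have := km i; have := kv i); lia.
have Ivl : interl v (toggle_up m v k).
  apply/interlP=> i; rewrite !Eu; have := km i; have := kv i.
  by case: i => [|i] /=; try (have := km i; have := kv i); lia.
exists (toggle_up m v k).
  rewrite !inE Iml Ivl /top Eu eqxx andbT /=; apply/eqP/(@addIn (wt k)).
  rewrite ks; apply: weight; first by rewrite Eu.
    by have := km K.-1; lia.
  by move=> i; rewrite Eu; have := km i; have := kv i; lia.
apply: ev_inj => i; rewrite ev_toggle_down // !Eu.
by have := km i; have := kv i; lia.
Qed.

End Interlacing.

(** * Chains of interlacing partitions *)

Section Chains.
Variables K N : nat.

Notation part := {ffun 'I_K -> 'I_N.+1}.
Implicit Types (l m v : part).

Definition part0 : part := mkpart K N (fun=> 0).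

Fixpoint chains_to j l : nat :=
  if j is j'.+1 then \sum_(m | interl m l) chains_to j' m else (l == part0).

Fixpoint chains_from i v (e : nat) : nat :=
  if i is i'.+1 then \sum_(l | interl v l) chains_from i' l e else (wt v == e).

(* U^i D U^j applied to the empty partition: climb to l, descend to v, climb to
   weight e. The exponent of t is n = wt l + (wt l - wt v) + (e - wt v). *)
Definition bent_chains j i (n : nat) : nat :=
  \sum_(e < N.+1) \sum_l \sum_(v | interl v l && (2 * wt l + e == n + 2 * wt v))
    chains_to j l * chains_from i v e.

Lemma ev_part0 i : ev part0 i = 0.
Proof. exact: ev_mkpart. Qed.

Lemma wt_part0 : wt part0 = 0.
Proof. by rewrite /wt big1 // => i _; rewrite ev_part0. Qed.

Lemma interl_part0 v : interl v part0 = (v == part0).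
Proof.
apply/interlP/eqP => [v0 | -> i]; last by rewrite !ev_part0.
by apply: ev_inj => i; have := v0 i; rewrite !ev_part0; lia.
Qed.

(** An interlacing step creates at most one new nonzero part. For [j < K] this supplies the
    condition [ev m K.-1 = 0] of [local_rule]. *)
Lemma chains_to_supp j l i : chains_to j l != 0 -> j <= i -> ev l i = 0.
Proof.
elim: j l i => [|j IHj] l i /=; first by case: (l =P part0) => [-> | _];
  rewrite ?ev_part0 ?eqxx.
rewrite sum_nat_eq0 negb_forall => /existsP[m]; rewrite negb_imply.
case/andP=> /interlP ml /IHj m0; case: i => // i le_ji.
by have := ml i; rewrite (m0 i) //; lia.
Qed.

Lemma chains_from_wt i v e : chains_from i v e != 0 -> wt v <= e.
Proof.
elim: i v => [|i IHi] v /=; first by case: (wt v =P e) => [-> | _];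
  rewrite ?eqxx.
rewrite sum_nat_eq0 negb_forall => /existsP[m]; rewrite negb_imply.
by case/andP=> /interl_wt vm /IHi /(leq_trans vm).
Qed.

(** A chain is cut at its [j]-th partition; the induction moves the cut one step at a time. *)
Lemma chains_glue i j e :
  \sum_l chains_to j l * chains_from i l e = chains_from (i + j) part0 e.
Proof.
elim: j i => [|j IHj] i.
  rewrite (bigD1 part0) //= eqxx mul1n addn0 big1 ?addn0 // => l.
  by move/negPf->.
rewrite addnS -addSn -IHj /=.
under eq_bigr => l _ do rewrite big_distrl big_mkcond /=.
rewrite exchange_big; apply: eq_bigr => m _ /=.
by rewrite -big_mkcond big_distrr.
Qed.

(** For fixed [m] and [v], this isolates the number of common neighbours [l], which [local_rule]
    evaluates. *)
Lemma sum_card_swap (P Q : rel part) (F G : part -> nat) :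
  \sum_l \sum_(v | P v l) (\sum_(m | Q m l) F m) * G v =
  \sum_m \sum_v F m * G v * #|[set l | Q m l && P v l]|.
Proof.
transitivity (\sum_l \sum_m \sum_v if Q m l && P v l then F m * G v else 0).
  apply: eq_bigr => l _; rewrite exchange_big big_mkcond; apply: eq_bigr => v _.
  case: (P v l); last by rewrite big1 // => m _; rewrite andbF.
  rewrite big_distrl big_mkcond; apply: eq_bigr => m _ /=.
  by rewrite andbT.
rewrite exchange_big; apply: eq_bigr => m _; rewrite exchange_big.
apply: eq_bigr => v _; rewrite -big_mkcond /= sum_nat_const mulnC.
by congr (_ * _); apply: eq_card => l; rewrite inE.
Qed.

Lemma sum_card_swap_dual (P : rel part) (Q : rel part) (F G : part -> nat) :
  \sum_m \sum_(k | P k m) F m * (\sum_(v | Q k v) G v) =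
  \sum_m \sum_v F m * G v * #|[set k | Q k v && P k m]|.
Proof.
apply: eq_bigr => m _.
transitivity (\sum_k \sum_v if Q k v && P k m then F m * G v else 0).
  rewrite big_mkcond; apply: eq_bigr => k _.
  case: (P k m); last by rewrite big1 // => v _; rewrite andbF.
  rewrite big_distrr big_mkcond; apply: eq_bigr => v _ /=.
  by rewrite andbT.
rewrite exchange_big; apply: eq_bigr => v _;
  rewrite -big_mkcond /= sum_nat_const mulnC.
by congr (_ * _); apply: eq_card => l; rewrite inE.
Qed.

Lemma bent_chains0 i n : n <= N -> bent_chains 0 i n = chains_from i part0 n.
Proof.
move=> nN; rewrite /bent_chains (bigD1 (inord n)) //= [X in _ + X]big1 ?addn0.
  rewrite (bigD1 part0) //= [X in _ + X]big1 ?addn0; last first.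
    by move=> l /negPf->; rewrite big1.
  rewrite eqxx (big_pred1 part0) ?mul1n ?inordK // => v.
  rewrite interl_part0 /=; have [-> | //] := eqVneq v part0.
  by rewrite addnC eqxx.
move=> e /eqP neq_en; rewrite big1 // => l _.
have [-> | _] := eqVneq l part0; last by rewrite big1.
rewrite big_pred0 // => v; rewrite interl_part0;
  have [-> | //] := eqVneq v part0.
rewrite wt_part0 /= muln0 addn0 add0n; apply/eqP=> eq_en; case: neq_en.
by apply/val_inj; rewrite /= inordK.
Qed.

(** Coefficient of [t^n] in [(1 - t^2) D U = U D], taken between [U^i] and [U^j]. A cell added to
    the peak [l] is both climbed and descended, hence the shift by 2. *)
Lemma bent_chainsS j i n : j < K -> n <= N ->
  bent_chains j.+1 i n =
  (if 2 <= n then bent_chains j.+1 i (n - 2) else 0) + bent_chains j i.+1 n.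
Proof.
move=> jK nN.
(* For [n >= 2] the shift is absorbed in the weight of [l]; for [n < 2] the new sum is empty since
   [wt v <= wt l]. *)
have -> : (if 2 <= n then bent_chains j.+1 i (n - 2) else 0) =
  \sum_(e < N.+1) \sum_l \sum_(v | interl v l && (2 * (wt l).+1 + e == n + 2 *
    wt v))
    chains_to j.+1 l * chains_from i v e.
  case: (ltnP 1 n) => n2.
    apply: eq_bigr => e _; apply: eq_bigr => l _; apply: eq_bigl => v.
    by congr (_ && _); apply/eqP/eqP; lia.
  rewrite big1 // => e _; rewrite big1 // => l _; rewrite big_pred0 // => v.
  by apply/negP=> /andP[/interl_wt vl /eqP]; lia.
rewrite -big_split; apply: eq_bigr => e _ /=.
rewrite !sum_card_swap sum_card_swap_dual -big_split; apply: eq_bigr => m _ /=.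
rewrite -big_split; apply: eq_bigr => v _ /=; rewrite -mulnDr.
have [-> // | /chains_to_supp m0] := eqVneq (chains_to j m) 0.
have [-> | /chains_from_wt ve] := eqVneq (chains_from i v e) 0;
  first by rewrite !muln0.
congr (_ * _).
(* [s] is the weight imposed on [l]. If no natural number satisfies the equation, all three counts
   vanish. *)
pose s := (n + 2 * wt v - e)./2.
have [Es | nEs] := eqVneq (2 * s + e) (n + 2 * wt v); last first.
  have nE t : 2 * t + e != n + 2 * wt v.
    by apply/eqP=> Et; case/eqP: nEs; rewrite -Et /s -Et; lia.
  rewrite !(eq_card0 (A := pred_of_set _)) //; move=> l; rewrite !inE.
  - apply/negP=> /and3P[/interl_wt lv /interl_wt lm /eqP El].
    by have /eqP := nE (wt m + wt v - wt l); lia.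
  - by apply/negP=> /and3P[_ _]; apply/negP/nE.
  - by apply/negP=> /and3P[_ _]; apply/negP/nE.
(* Once [wt v <= s], the bound [s <= N] follows: [2 * s = n + 2 * wt v - e <= n + wt v <= n + s]. *)
have [lt_sv | le_vs] := ltnP s (wt v).
  rewrite !(eq_card0 (A := pred_of_set _)) //; move=> l; rewrite !inE.
  - by apply/negP=> /and3P[/interl_wt lv /interl_wt lm /eqP El]; lia.
  - by apply/negP=> /and3P[/interl_wt lv /interl_wt lm /eqP El]; lia.
  - by apply/negP=> /and3P[/interl_wt lv /interl_wt lm /eqP El]; lia.
have mK : ev m K.-1 = 0 by apply: m0; lia.
transitivity #|[set l | [&& interl m l, interl v l & wt l == s]]|.
  apply: eq_card => l; rewrite !inE; congr [&& _, _ & _].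
  by apply/eqP/eqP; lia.
rewrite (local_rule v _ mK); [congr (_ + _) | lia | lia].
  apply: eq_card => l; rewrite !inE; congr [&& _, _ & _].
  by apply/eqP/eqP; lia.
apply: eq_card => k; rewrite !inE andbCA; congr [&& _, _ & _].
by apply/eqP/eqP; lia.
Qed.

(** This is [(1 - t) phi U = phi D] after [k] steps up, obtained from [local_rule] with
    [m = v = l]. *)
Lemma chains_fromS k n : k < K -> n <= N ->
  chains_from k.+1 part0 n =
  (if 1 <= n then chains_from k.+1 part0 (n - 1) else 0) + bent_chains k 0 n.
Proof.
move=> kK nN; rewrite -!(chains_glue 1 k).
have -> : (if 0 < n then \sum_l chains_to k l * chains_from 1 l (n - 1) else 0)
  = \sum_l chains_to k l * #|[set m | interl l m && ((wt m).+1 == n)]|.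
  case: (ltnP 0 n) => n0.
    apply: eq_bigr => l _ /=; congr (_ * _); rewrite -sum1_card big_mkcond.
    rewrite [RHS]big_mkcond; apply: eq_bigr => m _; rewrite inE /=.
    by case: interl => //=; case: eqP; case: eqP => //; lia.
  rewrite big1 // => l _; rewrite eq_card0 ?muln0 // => m; rewrite inE.
  by apply/negP=> /andP[_ /eqP]; lia.
have -> : bent_chains k 0 n =
    \sum_l chains_to k l * #|[set v | interl v l && (2 * wt l == n + wt v)]|.
  rewrite /bent_chains exchange_big; apply: eq_bigr => l _ /=.
  under eq_bigr => e _ do rewrite big_mkcond /=.
  rewrite exchange_big /= [RHS]mulnC -sum_nat_const [RHS]big_mkcond /=.
  apply: eq_bigr => v _; rewrite inE.
  case: ifP => [/andP[vl /eqP Ev] | nE].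
    (* The final weight [e] must be [wt v], which is in range because
       [2 * wt v <= 2 * wt l = n + wt v]. *)
    have vN : wt v < N.+1 by have := interl_wt vl; lia.
    rewrite (bigD1 (Ordinal vN)) //= vl eqxx muln1 ifT /=; last by apply/eqP;
      lia.
    rewrite big1 ?addn0 // => e /eqP neq_e; case: ifP => // _.
    by case: eqP => [Ee | _]; [case: neq_e; apply/val_inj | rewrite muln0].
  rewrite big1 // => e _; case: ifP => // /andP[vl /eqP Ee].
  case: eqP => [Eve | _]; last by rewrite muln0.
  by move: nE; rewrite vl /= => /eqP; lia.
rewrite -big_split; apply: eq_bigr => l _ /=; rewrite -mulnDr.
have [-> // | /chains_to_supp l0] := eqVneq (chains_to k l) 0.
congr (_ * _).
have lK : ev l K.-1 = 0 by apply: l0; lia.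
transitivity #|[set m | [&& interl l m, interl l m & wt m == n]]|.
  rewrite -sum1_card /= [RHS]big_mkcond [LHS]big_mkcond;
    apply: eq_bigr => m _ /=.
  by rewrite inE; case: interl; case: eqP.
rewrite (local_rule l _ lK) //; last by lia.
congr (_ + _); apply: eq_card => m; rewrite !inE; case: interl => //=.
by apply/eqP/eqP; lia.
Qed.

End Chains.

(** * Generating function in the number of cells *)

Section TruncatedPoly.
Variable N : nat.
Local Open Scope ring_scope.
Implicit Types p q r : {poly int}.

(** Congruence modulo [X^(N+1)]. *)
Definition eqt p q := forall i, (i <= N)%N -> p`_i = q`_i.

Lemma eqtM p p' q q' : eqt p p' -> eqt q q' -> eqt (p * q) (p' * q').
Proof.
move=> pp' qq' i le_iN; rewrite !coefM; apply: eq_bigr => j _.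
by rewrite pp' ?qq' // (leq_trans _ le_iN) ?leq_subr // -ltnS.
Qed.

Lemma eqt_prod (I : finType) (P : pred I) (F G : I -> {poly int}) :
  (forall i, P i -> eqt (F i) (G i)) ->
  eqt (\prod_(i | P i) F i) (\prod_(i | P i) G i).
Proof. by move=> FG; apply: (big_ind2 eqt) => // *; apply: eqtM. Qed.

Lemma eqtX p q n : eqt p q -> eqt (p ^+ n) (q ^+ n).
Proof.
by move=> pq; elim: n => [|n IHn] //; rewrite !exprS; apply: eqtM.
Qed.

(** Stands for [1 / (1 - X^w)]. Keeping every [c <= N], even past degree [N], makes it exactly the
    generating polynomial of one matrix entry bounded by [N]. *)
Definition geo w : {poly int} := \sum_(c < N.+1) 'X^(w * c).

Lemma geo_inv w : (0 < w)%N -> eqt ((1 - 'X^w) * geo w) 1.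
Proof.
move=> w0 i le_iN; rewrite /geo.
have -> : (1 - 'X^w) * \sum_(c < N.+1) 'X^(w * c) =
  1 - 'X^(w * N.+1) :> {poly int}.
  under eq_bigr do rewrite exprM.
  by rewrite -(opprB _ 1) mulNr -subrX1 opprB exprM.
rewrite coefB coefXn [i == _](_ : _ = false) ?subr0 //.
by apply/eqP; nia.
Qed.

Definition trunc (f : nat -> nat) : {poly int} := \poly_(i < N.+1) (f i)%:R.

Lemma trunc_diff (f g : nat -> nat) w :
  (forall n, (n <= N)%N ->
     f n = ((if w <= n then f (n - w)%N else 0) + g n)%N) ->
  eqt ((1 - 'X^w) * trunc f) (trunc g).
Proof.
move=> fg i le_iN; rewrite mulrBl mul1r coefB coefXnM !coef_poly ltnS le_iN.
rewrite [X in X%:R - _]fg // natrD; case: ltnP => [lt_iw | le_wi].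
  by rewrite add0r subr0.
rewrite ifT; last by rewrite ltnS (leq_trans (leq_subr _ _)).
by rewrite addrC addKr.
Qed.

Definition symgf k : {poly int} := \prod_(j < k) (geo 1 * geo 2 ^+ j).

Definition symden k : {poly int} :=
  \prod_(j < k) ((1 - 'X^1) * (1 - 'X^2) ^+ j).

Lemma symgf_inv k : eqt (symden k * symgf k) 1.
Proof.
have prod1 : \prod_(j < k) (1 : {poly int}) = 1 by rewrite big1.
rewrite /symden /symgf -big_split /= -[X in eqt _ X]prod1.
apply: eqt_prod => j _; rewrite mulrACA -exprMn -[X in eqt _ X]mulr1 -[X in eqt
  _ (_ * X)](expr1n _ j).
by apply: eqtM; [|apply: eqtX]; apply: geo_inv.
Qed.

End TruncatedPoly.

(** Bending the last step costs a factor [1 - X], and each of the [j] moves of the bend towards the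
    beginning costs [1 - X^2]; this relates the series for [j + 1] letters to that for [j]. *)
Lemma chains_gf K N k n : k <= K -> n <= N ->
  ((chains_from k (part0 K N) n)%:R = (symgf N k)`_n :> int)%R.
Proof.
move=> kK nN; pose A k := trunc N (chains_from k (part0 K N)).
pose C j i := trunc N (bent_chains K N j i).
have Cbend j i : (j < K)%N -> eqt N ((1 - 'X^2) * C j.+1 i)%R (C j i.+1).
  by move=> jK; apply: trunc_diff => m mN; exact: bent_chainsS.
have AC j : (j < K)%N -> eqt N ((1 - 'X^1) * A j.+1)%R (C j 0).
  by move=> jK; apply: trunc_diff => m mN; exact: chains_fromS.
have CA j i : (j <= K)%N -> eqt N ((1 - 'X^2) ^+ j * C j i)%R (A (i + j)).
  elim: j i => [|j IHj] i jK m mN.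
    by rewrite expr0 mul1r addn0 !coef_poly ltnS mN bent_chains0.
  rewrite exprSr -mulrA addnS -addSn -(IHj i.+1 (ltnW jK)) //.
  by apply: eqtM mN => //; exact: Cbend.
have AA j : (j <= K)%N -> eqt N (symden j * A j)%R 1%R.
  elim: j => [|j IHj] jK m mN.
    by rewrite /symden big_ord0 mul1r coef_poly ltnS mN /= wt_part0 coef1
      eq_sym.
  rewrite -(IHj (ltnW jK)) // /symden big_ord_recr /= -mulrA.
  apply: eqtM (mN) => // i iN.
  have -> : ((1 - 'X^1) * (1 - 'X^2) ^+ j * A j.+1 =
             (1 - 'X^2) ^+ j * ((1 - 'X^1) * A j.+1) :> {poly int})%R.
    by rewrite mulrA; congr (_ * _)%R; rewrite mulrC.
  rewrite -[j in A j]add0n -(CA j 0) ?(ltnW jK) //.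
  by apply: eqtM iN => //; exact: AC.
transitivity (((A k)`_n)%R : int); first by rewrite coef_poly ltnS nN.
(* [A k] and [symgf N k] are both inverse to [symden k], hence congruent. *)
have -> : ((A k)`_n = (A k * (symden k * symgf N k))`_n)%R.
  by rewrite -[X in _ (polyseq X) _ = _](mulr1 (A k));
    apply: eqtM nN => // i iN; rewrite symgf_inv.
rewrite mulrA [(A k * _)%R]mulrC -[X in _ = _ (polyseq X) _](mul1r (symgf N k)).
by apply: eqtM nN => //; exact: AA.
Qed.

(** * Generating function of symmetric matrices by entry sum *)

Section SymmetricMatrices.
Variables k N : nat.

Notation mat := {ffun 'I_k * 'I_k -> 'I_N.+1}.
Implicit Types (f : mat) (p : 'I_k * 'I_k).

Definition symmat f := [forall i, forall j, f (i, j) == f (j, i)].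

Definition swap (p : 'I_k * 'I_k) := (p.2, p.1).

Definition pw p := if p.1 == p.2 then 1 else 2.

Lemma symmatP f : reflect (forall i j, f (i, j) = f (j, i)) (symmat f).
Proof.
by apply: (iffP forallP) => fs i; [move=> j; have /forallP/(_ j)/eqP := fs i
  | apply/forallP => j; apply/eqP].
Qed.

Lemma sum_symmat f : symmat f ->
  \sum_p f p = \sum_(p : 'I_k * 'I_k | p.1 <= p.2) pw p * f p.
Proof.
move/symmatP=> fs; rewrite (bigID (fun p : 'I_k * 'I_k => p.1 <= p.2)) /=.
rewrite [X in _ + X](reindex_inj (h := swap)); last first.
  by move=> [i j] [i' j'] [-> ->].
rewrite /= big_mkcond [X in _ + X]big_mkcond [RHS]big_mkcond -big_split.
apply: eq_bigr => -[i j] _;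
  rewrite /pw /swap /= -ltnNge -(inj_eq val_inj) /= fs.
by case: ltngtP => //= _; rewrite ?mul1n ?addn0 ?mul2n ?addnn.
Qed.

Definition symext f : mat := [ffun p : 'I_k * 'I_k =>
  if p.1 <= p.2 then f p else f (swap p)].
Definition upper f : mat := [ffun p : 'I_k * 'I_k =>
  if p.1 <= p.2 then f p else ord0].

(** The entries on and above the diagonal are free. Column [j] has one diagonal entry, counted once,
    and [j] entries above it, counted twice. *)
Lemma symmat_gf :
  (\sum_(f | symmat f) 'X^(\sum_p f p) = symgf N k :> {poly int})%R.
Proof.
have -> : symgf N k = (\prod_(p : 'I_k * 'I_k | (p.1 <= p.2)%N)
    \sum_(c : 'I_N.+1 | true) 'X^(pw p * c))%R.
  rewrite /symgf -(pair_big_dep xpredT (fun i j : 'I_k => i <= j)%N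
    (fun i j => \sum_(c : 'I_N.+1) 'X^(pw (i, j) * c)))%R /=.
  rewrite (exchange_big_dep xpredT) //=; apply: eq_bigr => j _.
  rewrite (bigD1 j) //= {1}/pw /= eqxx; congr (_ * _)%R.
  rewrite (eq_bigr (fun=> geo N 2)); last first.
    by move=> i /andP[_ /negPf nij]; rewrite /pw /= nij.
  rewrite prodr_const; congr (_ ^+ _)%R.
  rewrite -[LHS](@card_ord_ltn k) ?(ltnW (ltn_ord j)) //; apply: eq_card => i.
  by rewrite inE unfold_in -(inj_eq val_inj) /= andbC -ltn_neqAle.
(* Expanding the product gives a sum over functions that vanish below the diagonal; [symext] and
   [upper] match them with symmetric matrices. *)
rewrite (big_distr_big ord0) /= (reindex_onto symext upper) /=; last first.
  move=> f /symmatP fs; apply/ffunP=> -[i j]; rewrite !ffunE /=.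
  by case: (ltnP j i) => [/ltnW -> | //]; rewrite fs.
have symextK f p : p.1 <= p.2 -> symext f p = f p by rewrite ffunE => ->.
have sym_symext f : symmat (symext f).
  apply/symmatP=> i j; rewrite !ffunE /swap /=.
  by case: ltngtP => // eq_ij; have -> : i = j by apply: val_inj.
apply: eq_big => f.
  rewrite sym_symext /=; apply/eqP/pfamilyP => [<- | [/subsetP supp _]].
    by split=> //; apply/subsetP=> p; rewrite unfold_in ffunE unfold_in /=;
      case: leqP.
  apply/ffunP=> p; rewrite ffunE; case: ifP => [/symextK-> // | nle].
  by apply/esym/eqP/negPn/negP => /supp; rewrite unfold_in nle.
move=> _; rewrite sum_symmat // -prodrXr; apply: eq_bigr => p /symextK-> //.
Qed.

Lemma card_symmat n :
  (#|[set f | symmat f & (\sum_p f p == n)%N]|%:R = (symgf N k)`_n :> int)%R.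
Proof.
rewrite -symmat_gf coef_sum -sum1_card natr_sum big_mkcond [RHS]big_mkcond /=.
apply: eq_bigr => f _; rewrite inE coefXn eq_sym.
by case: symmat => //=; case: eqP.
Qed.

End SymmetricMatrices.

Lemma card_chains K N k n : k <= K -> n <= N ->
  chains_from k (part0 K N) n =
  #|[set f : {ffun 'I_k * 'I_k -> 'I_N.+1} | symmat f & \sum_p f p == n]|.
Proof.
move=> kK nN; apply/eqP; rewrite -(Num.Theory.eqr_nat int); apply/eqP.
by rewrite chains_gf // card_symmat.
Qed.

(** * Tableaux as chains *)

(** Allows cells and letters to be recovered from column heights, row lengths and other
    cardinalities. *)
Lemma mem_downclosed n (A : {set 'I_n}) :
  (forall i j : 'I_n, i <= j -> j \in A -> i \in A) ->
  forall i : 'I_n, (i \in A) = (i < #|A|).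
Proof.
move=> downA i; apply/idP/idP => [Ai | lt_iA].
  rewrite -[i.+1](@card_ord_ltn n) ?ltn_ord // subset_leq_card //.
  by apply/subsetP=> j; rewrite inE ltnS => /downA; apply.
apply: contraLR lt_iA => nAi; rewrite -leqNgt.
rewrite -[X in _ <= X](@card_ord_ltn n) ?(ltnW (ltn_ord i)) //
  subset_leq_card //.
apply/subsetP=> j Aj; rewrite inE ltnNge; apply: contra nAi => /downA; exact.
Qed.

Lemma chains_from_path K N i (v : {ffun 'I_K ->
  'I_N.+1}) e : chains_from i v e =
  #|[set t : i.-tuple {ffun 'I_K ->
    'I_N.+1} | path (@interl K N) v t & wt (last v t) == e]|.
Proof.
elim: i v => [|i IHi] v /=.
  case: eqP => [<- | neq].
    by apply/esym/(eq_card1 (x := [tuple])) => t; rewrite !inE tuple0 /= !eqxx.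
  by rewrite eq_card0 // => t; rewrite inE tuple0 /=; apply/eqP.
rewrite -sum1_card.
rewrite (reindex (fun p : {ffun 'I_K -> 'I_N.+1} * i.-tuple _ =>
  [tuple of p.1 :: p.2])) /=; last first.
  exists (fun t : i.+1.-tuple _ => (thead t, [tuple of behead t])) =>
    [[l t] _ | t _] /=.
    by congr (_, _); apply: val_inj.
  by rewrite -tuple_eta.
rewrite -(pair_big_dep xpredT
  (fun l (t : i.-tuple _) => [tuple of l :: t] \in [set t :
    i.+1.-tuple _ | _ & _])
  (fun _ _ => 1)) /= [LHS]big_mkcond.
apply: eq_bigr => l _; rewrite IHi -sum1_card; case: ifP => vl.
  by apply: eq_bigl => t; rewrite !inE /= vl.
by rewrite big_pred0 // => t; rewrite inE /= vl.
Qed.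

Section TableauChains.
Variables K n k : nat.
Hypothesis nK : n <= K.

Notation part := {ffun 'I_K -> 'I_n.+1}.
Notation p0 := (part0 K n).
Implicit Types (T : filling n k) (t : k.-tuple part) (v : part).

Definition below T (i : nat) (r c : 'I_n) : bool :=
  if T (r, c) is Some x then x < i else false.

(** Column lengths are recorded because rows are strict: a letter occurs at most once in each row,
    which makes successive column lengths interlace. *)
Definition colcount T i : part := mkpart K n (fun c =>
  if insub c is Some c' then #|[set r | below T i r c']| else 0).

Definition chain_of T : k.-tuple part := [tuple colcount T j.+1 | j < k].

(** [chain_of] omits the initial empty partition; it is restored here at index 0. *)
Definition stage t i : part := nth p0 (p0 :: t) i.

Lemma ev_colcount T i (c : 'I_n) :
  ev (colcount T i) c = #|[set r | below T i r c]|.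
Proof.
rewrite ev_mkpart ?valK // => [j | j leKj].
  by case: insub => // c'; rewrite -[X in _ <= X](card_ord n) max_card.
by rewrite insubF // ltnNge (leq_trans nK leKj).
Qed.

Lemma ev_colcount_oversize T i c : n <= c -> ev (colcount T i) c = 0.
Proof.
move=> le_nc; rewrite ev_mkpart ?insubF // => [|j|j leKj];
  first by rewrite ltnNge le_nc.
  by case: insub => // c'; rewrite -[X in _ <= X](card_ord n) max_card.
by rewrite insubF // ltnNge (leq_trans nK leKj).
Qed.

Lemma stage_chain_of T i : i <= k -> stage (chain_of T) i = colcount T i.
Proof.
case: i => [_ | i lt_ik].
  apply: ev_inj => c; rewrite ev_part0; case: (ltnP c n) => [lt_cn | le_nc].
    rewrite -[c]/(val (Ordinal lt_cn)) ev_colcount eq_card0 // => r;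
      rewrite inE.
    by rewrite /below; case: (T _).
  by rewrite ev_colcount_oversize.
by rewrite -[LHS]/(nth p0 (chain_of T) (Ordinal lt_ik)) -tnth_nth tnth_mktuple.
Qed.

Lemma stage_path t : path (@interl K n) p0 t ->
  forall i, i < k -> interl (stage t i) (stage t i.+1).
Proof. by move/(pathP p0) => pt i lt_ik; apply: pt; rewrite size_tuple. Qed.

Lemma stage_last t : stage t k = last p0 t.
Proof. by rewrite (last_nth p0) size_tuple. Qed.

Lemma ferrers_mem (D : {set 'I_n * 'I_n}) (r r' c c' : 'I_n) :
  is_ferrers D -> r <= r' -> c <= c' -> (r', c') \in D -> (r, c) \in D.
Proof.
case/existsP=> lam /andP[/forallP lamD /eqP->] le_r le_c; rewrite !inE /=.
move/forallP/(_ r')/implyP: (lamD r) => /(_ le_r) le_lam lt_c'.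
exact: leq_ltn_trans le_c (leq_trans lt_c' le_lam).
Qed.

Lemma belowW T (r r' c : 'I_n) i : is_ssyt T -> r <= r' -> below T i r' c ->
  below T i r c.
Proof.
case/and4P=> FT _ _ /forallP/(_ c)/forallP/(_ r)/forallP/(_ r')/implyP cw le_r.
rewrite /below; case ET': (T (r', c)) => [x'|//] lt_x'i.
have : (r, c) \in Defs.shape T by apply: ferrers_mem FT le_r (leqnn c) _;
  rewrite inE ET'.
rewrite inE; case ET: (T (r, c)) cw => [x|//] cw _.
move: le_r; rewrite leq_eqVlt => /predU1P[/val_inj eq_r | /cw]; last first.
  by rewrite ET' /= => /leq_ltn_trans; apply.
by move: ET; rewrite eq_r ET' => -[<-].
Qed.

(** Strictness of rows yields the lower inequality of [interl] between stages [i] and [i.+1]. *)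
Lemma below_left T (r c c' : 'I_n) i : is_ssyt T -> c < c' ->
  below T i.+1 r c' -> below T i r c.
Proof.
case/and4P=> FT _ /forallP/(_ r)/forallP/(_ c)/forallP/(_ c')/implyP rs _ lt_c.
rewrite /below; case ET': (T (r, c')) => [x'|//] lt_x'i.
have : (r, c) \in Defs.shape T.
  by apply: ferrers_mem FT (leqnn r) (ltnW lt_c) _; rewrite inE ET'.
rewrite inE; case ET: (T (r, c)) rs => [x|//] rs _.
by move: (rs lt_c); rewrite ET' /= => /leq_trans; apply.
Qed.

Lemma below_colcount T (r c : 'I_n) i : is_ssyt T ->
  below T i r c = (r < ev (colcount T i) c).
Proof.
move=> sT; rewrite ev_colcount -mem_downclosed ?inE // => r1 r2 le_r.
by rewrite !inE; apply: belowW.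
Qed.

Lemma below_eq T T' : (forall i r c, i <= k ->
  below T i r c = below T' i r c) -> T = T'.
Proof.
move=> eqb; apply/ffunP=> -[r c].
case ET: (T (r, c)) => [x|]; case ET': (T' (r, c)) => [x'|] //.
- have /esym := eqb x r c (ltnW (ltn_ord x));
  have := eqb x' r c (ltnW (ltn_ord x')).
  rewrite /below ET ET' !ltnn => /negbT + /negbT; rewrite -!leqNgt => le1 le2.
  by congr Some; apply/val_inj/eqP; rewrite eqn_leq le1 le2.
- by have := eqb k r c (leqnn k); rewrite /below ET ET' ltn_ord.
- by have := eqb k r c (leqnn k); rewrite /below ET ET' ltn_ord.
Qed.

Lemma below_shape T r c : below T k r c = ((r, c) \in Defs.shape T).
Proof. by rewrite inE /below; case: (T _) => // x; rewrite ltn_ord. Qed.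

Lemma wt_ord_n v : (forall c, n <= c -> ev v c = 0) ->
  wt v = \sum_(c < n) ev v c.
Proof.
move=> v0; rewrite /wt (big_ord_widen K (ev v) nK) [RHS]big_mkcond /=.
by apply: eq_bigr => c _; case: (ltnP c n) => // /v0.
Qed.

Lemma card_shape T : #|Defs.shape T| = \sum_(c < n) #|[set r | below T k r c]|.
Proof.
rewrite -sum1_card; under [RHS]eq_bigr do rewrite -sum1_card.
rewrite [RHS](exchange_big_dep xpredT) //= pair_big_dep /=.
by apply: eq_bigl => -[r c]; rewrite /= [in RHS]inE below_shape.
Qed.

Lemma chain_of_path T : is_ssyt T ->
  path (@interl K n) p0 (chain_of T) /\ wt (last p0 (chain_of T)) = n.
Proof.
move=> sT; split; last first.
  rewrite -stage_last stage_chain_of // wt_ord_n;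
    last exact: ev_colcount_oversize.
  under eq_bigr do rewrite ev_colcount.
  by rewrite -card_shape; case/and4P: sT => _ /eqP.
apply/(pathP p0) => i; rewrite size_tuple => lt_ik.
rewrite -/(stage (chain_of T) i) -[nth _ (chain_of T) i]/(stage (chain_of T)
  i.+1).
rewrite !stage_chain_of ?(ltnW lt_ik) //; apply/interlP=> c; apply/andP; split.
  case: (ltnP c.+1 n) => [lt_cn | ?]; last by rewrite ev_colcount_oversize.
  rewrite -[c.+1]/(val (Ordinal lt_cn)) -[c in X in _ <= X]/(val (Ordinal (ltnW
    lt_cn))).
  rewrite !ev_colcount subset_leq_card //; apply/subsetP=> r; rewrite !inE.
  exact: below_left.
case: (ltnP c n) => [lt_cn | ?]; last by rewrite ev_colcount_oversize.
rewrite -[c]/(val (Ordinal lt_cn)) !ev_colcount subset_leq_card //.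
apply/subsetP=> r; rewrite !inE /below; case: (T _) => // x /leq_trans; apply.
by rewrite leqnSn.
Qed.

Lemma chain_of_inj : {in [pred T | is_ssyt T] &, injective chain_of}.
Proof.
move=> T T' sT sT' eq_c; apply: below_eq => i r c le_ik.
by rewrite !below_colcount // -!stage_chain_of // eq_c.
Qed.

(** The letter of a cell is the number of stages from 1 to [k] that do not yet contain it. If none
    contains it, this number is [k] and [insub] leaves the cell empty. *)
Definition tab_of t : filling n k :=
  [ffun rc : 'I_n * 'I_n => insub #|[set j :
    'I_k | ev (stage t j.+1) rc.2 <= rc.1]|].

Section TabOf.
Variable t : k.-tuple part.
Hypothesis pt : path (@interl K n) p0 t.
Hypothesis wt_last : wt (last p0 t) = n.

Lemma stage_mono i i' c : i <= i' <= k -> ev (stage t i) c <= ev (stage t i') c.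
Proof.
elim: i' => [|i' IHi']; first by case: i.
case/andP; rewrite leq_eqVlt => /predU1P[-> // | le_i lt_k].
apply: leq_trans (IHi' _) _; first by rewrite -ltnS le_i ltnW.
by have /interlP/(_ c)/andP[] := stage_path pt lt_k.
Qed.

Lemma stage_left i c : i < k -> ev (stage t i.+1) c.+1 <= ev (stage t i) c.
Proof. by move=> lt_k; have /interlP/(_ c)/andP[] := stage_path pt lt_k. Qed.

Lemma stage_decr i c c' : i <= k -> c <= c' ->
  ev (stage t i) c' <= ev (stage t i) c.
Proof.
move=> le_ik; elim: c' => [|c' IHc']; first by case: c.
rewrite leq_eqVlt => /predU1P[-> // | /IHc']; apply: leq_trans.
case: i le_ik {IHc'} => [|i] lt_ik; first by rewrite !ev_part0.
by apply: leq_trans (stage_left _ lt_ik) (stage_mono _ _); rewrite leqnSn.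
Qed.

(** A nonzero part of index at least [n] would make the parts 0 to [n] of the last stage all
    nonzero, and its weight would exceed [n]. *)
Lemma stage_oversize i c : i <= k -> n <= c -> ev (stage t i) c = 0.
Proof.
move=> le_ik le_nc; apply/eqP; rewrite -leqn0.
apply: leq_trans (stage_mono (i' := k) _ _) _; first by rewrite le_ik leqnn.
apply: leq_trans (stage_decr (leqnn k) le_nc) _; rewrite leqNgt;
  apply/negP=> n0.
have ltnK : n < K by rewrite ltnNge; apply: contraL n0 => ?;
  rewrite ev_oversize.
suff : n < wt (stage t k) by rewrite stage_last wt_last ltnn.
rewrite /wt -[n.+1]card_ord -sum1_card (big_ord_widen K (fun=> 1) ltnK)
  big_mkcond.
apply: leq_sum => j _; case: ifP => // /=; rewrite ltnS => le_jn.
exact: leq_trans n0 (stage_decr (leqnn k) le_jn).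
Qed.

Lemma below_tab_of i (r c : 'I_n) : i <= k ->
  below (tab_of t) i r c = (r < ev (stage t i) c).
Proof.
move=> le_ik; rewrite /below ffunE /=; set A := [set j | _].
have downA (j j' : 'I_k) : j <= j' -> j' \in A -> j \in A.
  move=> le_j; rewrite !inE; apply: leq_trans.
  by apply: stage_mono; rewrite ltnS le_j ltn_ord.
transitivity (#|A| < i).
  (* For an empty cell [#|A|] is at least [k], so both sides are false as [i <= k]. *)
  case: insubP => [x _ -> // | nlt]; apply/esym/negbTE; rewrite -leqNgt.
  by rewrite (leq_trans le_ik) // leqNgt.
case: i le_ik => [|i] lt_ik; first by rewrite ev_part0.
have := mem_downclosed downA (Ordinal lt_ik); rewrite inE /= => lt_iA.
by rewrite ltnS leqNgt -lt_iA -ltnNge.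
Qed.

Lemma card_below_tab_of i (c : 'I_n) : i <= k ->
  #|[set r | below (tab_of t) i r c]| = ev (stage t i) c.
Proof.
move=> le_ik; rewrite -[RHS](@card_ord_ltn n) ?ev_leN //.
by apply: eq_card => r; rewrite !inE below_tab_of.
Qed.

Lemma tab_of_ssyt : is_ssyt (tab_of t).
Proof.
apply/and4P; split.
- have lamn (r : 'I_n) : #|[set c : 'I_n | r < ev (stage t k) c]| < n.+1.
    by rewrite ltnS -[X in _ <= X](card_ord n) max_card.
  apply/existsP; exists [ffun r => Ordinal (lamn r)]; apply/andP; split.
    apply/forallP=> r; apply/forallP=> r'; apply/implyP=> le_r;
      rewrite !ffunE /=.
    by apply/subset_leq_card/subsetP=> c; rewrite !inE; apply: leq_ltn_trans.
  apply/eqP/setP=> -[r c]; rewrite -below_shape below_tab_of // !inE ffunE /=.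
  rewrite -mem_downclosed ?inE // => c1 c2 le_c; rewrite !inE => /leq_trans;
    apply.
  exact: stage_decr.
- rewrite card_shape; under eq_bigr do rewrite card_below_tab_of //.
  rewrite -wt_ord_n ?stage_last ?wt_last // => c; rewrite -stage_last.
  exact: stage_oversize.
- apply/forallP=> r; apply/forallP=> c; apply/forallP=> c'; apply/implyP=> lt_c.
  case ET: (tab_of t (r, c)) => [x|//];
    case ET': (tab_of t (r, c')) => [x'|//] /=.
  have : below (tab_of t) x'.+1 r c' by rewrite /below ET' leqnn.
  rewrite below_tab_of // => lt_r.
  have : below (tab_of t) x' r c; last by rewrite /below ET.
  rewrite below_tab_of ?(ltnW (ltn_ord x')) // (leq_trans lt_r) //.
  apply: leq_trans (stage_left c (ltn_ord x')); exact: stage_decr.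
- apply/forallP=> c; apply/forallP=> r; apply/forallP=> r'; apply/implyP=> lt_r.
  case ET: (tab_of t (r, c)) => [x|//];
    case ET': (tab_of t (r', c)) => [x'|//] /=.
  have : below (tab_of t) x'.+1 r' c by rewrite /below ET' leqnn.
  rewrite below_tab_of // => /(ltn_trans lt_r).
  by rewrite -below_tab_of // /below ET.
Qed.

Lemma tab_ofK : chain_of (tab_of t) = t.
Proof.
apply: eq_from_tnth => j; rewrite !(tnth_nth p0).
rewrite -[LHS]/(stage (chain_of _) j.+1) -[RHS]/(stage t j.+1) stage_chain_of
  //.
apply: ev_inj => c; case: (ltnP c n) => [lt_cn | le_nc].
  by rewrite -[c]/(val (Ordinal lt_cn)) ev_colcount card_below_tab_of.
by rewrite ev_colcount_oversize // stage_oversize.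
Qed.

End TabOf.

Lemma num_ssyt_chains : num_ssyt n k = chains_from k p0 n.
Proof.
rewrite chains_from_path /num_ssyt -(card_in_imset (f := chain_of)); last first.
  by move=> T T'; rewrite !inE; apply: chain_of_inj.
apply: eq_card => t; rewrite inE; apply/imsetP/andP.
  by case=> T + ->; rewrite inE => /chain_of_path[-> ->].
case=> pt /eqP wt_t; exists (tab_of t); last by rewrite tab_ofK.
by rewrite inE tab_of_ssyt.
Qed.

End TableauChains.

(** * Symmetric matrices as labelled involutions *)

Section LabelledInvolutions.
Variables n k : nat.

Notation lab := {ffun 'I_n -> 'I_k}.
Notation mat := {ffun 'I_k * 'I_k -> 'I_n.+1}.
Implicit Types (s : 'S_n) (a : lab) (p q : 'I_n).

Definition compat s a := [forall p : 'I_n, forall q : 'I_n,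
  (q == p.+1 :> nat) ==> (a p + (s q < s p) <= a q)].

(** Equal labels at [p] and [q] exclude any descent of [s] in between, so [s] increases from [p] to
    [q]. *)
Lemma compat_lt s a p q : compat s a -> p < q ->
  (a p < a q) || (a p == a q :> nat) && (s p < s q).
Proof.
move=> /forallP sa; case: q => m lt_mn;
  elim: m lt_mn => [|m IHm] lt_mn //= lt_pm.
have lt_mn' : m < n by apply: ltnW.
have := sa (Ordinal lt_mn') => /forallP/(_ (Ordinal lt_mn))/implyP/(_ (eqxx _)).
have neq : val (s (Ordinal lt_mn')) != val (s (Ordinal lt_mn)).
  rewrite (inj_eq val_inj) (inj_eq perm_inj) -(inj_eq val_inj) /=.
  by rewrite neq_ltn leqnn.
have [lt_pm' | ] := ltnP p m; first by have := IHm lt_mn' lt_pm';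
  move: neq => /=; lia.
move=> le_mp; have -> : p = Ordinal lt_mn' by apply: val_inj => /=; lia.
by move: neq => /=; lia.
Qed.

Lemma compat_le s a p q : compat s a -> p <= q -> a p <= a q.
Proof.
move=> sa; rewrite leq_eqVlt => /predU1P[/val_inj-> // | /(compat_lt sa)].
by lia.
Qed.

Definition cmat s a : mat :=
  [ffun ij => inord #|[set p | (a p == ij.1) && (a (s p) == ij.2)]|].

Lemma cmatE s a i j :
  cmat s a (i, j) = #|[set p | (a p == i) && (a (s p) == j)]| :> nat.
Proof. by rewrite ffunE inordK // ltnS -[X in _ <= X](card_ord n) max_card. Qed.

Lemma involutionsP s : reflect (involutive s) (s \in involutions n).
Proof. by rewrite inE; apply: (iffP forallP) => sK p; apply/eqP. Qed.

Lemma cmat_sym s a : s \in involutions n -> symmat (cmat s a).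
Proof.
move/involutionsP=> sK; apply/symmatP=> i j; apply: val_inj; rewrite /= !cmatE.
rewrite -(card_imset _ (@perm_inj _ s)); apply: eq_card => p; rewrite inE.
apply/imsetP/idP => [[q + ->] | /andP[pi pj]].
  by rewrite inE sK andbC.
by exists (s p); rewrite ?sK // inE sK andbC pi.
Qed.

Lemma cmat_sum s a : \sum_ij cmat s a ij = n.
Proof.
transitivity (\sum_ij \sum_(p | ij == (a p, a (s p))) 1).
  apply: eq_bigr => -[i j] _; rewrite cmatE -sum1_card.
  by apply: eq_bigl => p; rewrite inE [RHS]eq_sym xpair_eqE.
rewrite (exchange_big_dep xpredT) //= -[RHS](card_ord n) -sum1_card.
by apply: eq_bigr => p _; rewrite big_pred1_eq.
Qed.

Definition lexle (x y : 'I_k * 'I_k) :=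
  (x.1 < y.1) || (x.1 == y.1) && (x.2 <= y.2).

(** Recovers a permutation from the relative order of its values. *)
Lemma val_perm_card s p : val (s p) = #|[set q | s q < s p]|.
Proof.
rewrite -(card_imset _ (@perm_inj _ s)) /=.
rewrite -[LHS](@card_ord_ltn n) ?(ltnW (ltn_ord _)) //; apply: eq_card => q.
rewrite inE; apply/idP/imsetP => [lt_q | [r + ->]]; last by rewrite inE.
by exists (s^-1%g q); rewrite ?permKV // inE permKV.
Qed.

(* Hence s is determined by a and by a \o s. *)
Lemma compat_perm_lt s a p q : s \in involutions n -> compat s a ->
  (s p < s q) = (a (s p) < a (s q)) || (a (s p) == a (s q) :> nat) && (p < q).
Proof.
move/involutionsP=> sK sa.
case: (ltngtP (s p) (s q)) => [/(compat_lt sa) | /(compat_lt sa) | eq_s].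
- by rewrite !sK; lia.
- by rewrite !sK; lia.
have -> : p = q by apply: (@perm_inj _ s); apply: val_inj.
by lia.
Qed.

(** The pairs [(a p, a (s p))], read along [p], form a lexicographically sorted list whose
    multiplicities are the matrix entries. The matrix thus determines [a] and [a \o s], and these
    determine [s]. *)
Lemma cmat_inj s s' a a' : s \in involutions n -> s' \in involutions n ->
  compat s a -> compat s' a' -> cmat s a = cmat s' a' -> (s, a) = (s', a').
Proof.
move=> Is Is' sa sa' eqA.
pose w s a := [seq (a p, a (s p)) | p : 'I_n] : seq ('I_k * 'I_k).
have sw s1 a1 : compat s1 a1 -> sorted lexle (w s1 a1).
  move=> sa1; rewrite /w sorted_map.
  apply: (@sub_sorted _ (fun p q : 'I_n => p < q)).
    move=> p q /(compat_lt sa1) /orP[lt | /andP[/eqP eq_a /ltnW/(compat_le sa1)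
      le]].
      by rewrite /lexle /= lt.
    by rewrite /lexle /= -(inj_eq val_inj) /= eq_a eqxx le orbT.
  by have := iota_ltn_sorted 0 n; rewrite -val_enum_ord sorted_map.
have cw s1 a1 i j : count_mem (i, j) (w s1 a1) = cmat s1 a1 (i, j).
  rewrite cmatE /w count_map -sum1_count -sum1_card big_enum_cond /=.
  by apply: eq_bigl => p; rewrite inE /= xpair_eqE.
have eqw : w s a = w s' a'.
  apply: (sorted_eq (leT := lexle)).
  - by move=> y x z; rewrite /lexle -!(inj_eq val_inj) /=; lia.
  - move=> [i j] [i' j']; rewrite /lexle -!(inj_eq val_inj) /= => le2.
    by congr (_, _); apply: val_inj => /=; lia.
  - exact: sw.
  - exact: sw.
  by apply/allP=> -[i j] _; rewrite /= !cw eqA.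
have eqp p : (a p, a (s p)) = (a' p, a' (s' p)).
  by have /eq_in_map/(_ p) := eqw; apply; rewrite mem_enum.
have eqa : a = a' by apply/ffunP=> p; case: (eqp p).
suff -> : s = s' by rewrite eqa.
apply/permP=> p; apply: val_inj; rewrite [LHS]val_perm_card [RHS]val_perm_card.
apply: eq_card => q; rewrite !inE (compat_perm_lt _ _ Is sa) (compat_perm_lt _
  _ Is' sa').
by case: (eqp p) => _ ->; case: (eqp q) => _ ->.
Qed.

(** * From a symmetric matrix to a labelled involution *)

Section Sorting.
Variable A : mat.
Hypothesis symA : symmat A.
Hypothesis sumA : \sum_ij A ij = n.

Notation cell := ('I_k * 'I_k * 'I_n.+1)%type.
Implicit Types x y : cell.

(* The pairs (i, j) with multiplicity A (i, j), copies being told apart by c. *)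
Definition cells : {set cell} := [set x : cell | x.2 < A x.1].

Definition cle x y := (x.1.1 < y.1.1) || (x.1.1 == y.1.1 :> nat) &&
  ((x.1.2 < y.1.2) || (x.1.2 == y.1.2 :> nat) && (x.2 <= y.2)).

Definition flip x : cell := ((x.1.2, x.1.1), x.2).

Lemma cells_fiber ij : #|[set x : cell in cells | x.1 == ij]| = A ij.
Proof.
rewrite -[RHS](@card_ord_ltn n.+1) ?(ltnW (ltn_ord _)) //.
have inj : injective (pair ij : 'I_n.+1 -> cell) by move=> c c' [].
rewrite -[RHS](card_imset _ inj); apply: eq_card => -[ij' c]; rewrite !inE /=.
apply/andP/imsetP => [[lt /eqP eq_ij] | [c' + [-> ->]]].
  by exists c; rewrite -?eq_ij // inE.
by rewrite inE eqxx.
Qed.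

Lemma card_cells : #|cells| = n.
Proof.
rewrite -[RHS]sumA -sum1_card (partition_big fst xpredT) //=.
apply: eq_bigr => ij _; rewrite -cells_fiber -sum1_card.
by apply: eq_bigl => x; rewrite inE.
Qed.

Lemma cell_seq : {e : 'I_n -> cell | [/\ injective e, forall x, x \in cells ->
  exists p, e p = x,
  forall p, e p \in cells & forall p q, p < q -> cle (e p) (e q)]}.
Proof.
pose r := sort cle (enum cells).
have cle_total : total cle by move=> x y; rewrite /cle; lia.
have cle_trans : transitive cle by move=> y x z; rewrite /cle; lia.
have size_r : size r = n by rewrite size_sort -cardE card_cells.
have mem_r x : (x \in r) = (x \in cells) by rewrite mem_sort mem_enum.
have uniq_r : uniq r by rewrite sort_uniq enum_uniq.
pose t := Tuple (introT eqP size_r).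
exists (tnth t); split.
- by apply/tuple_uniqP.
- by move=> x; rewrite -mem_r => /(tnthP t)[p ->]; exists p.
- by move=> p; rewrite -mem_r; exact: (mem_tnth p t).
move=> p q lt_pq; have x0 := tnth t p; rewrite !(tnth_nth x0) /=.
by apply: (sorted_ltn_nth cle_trans) => //; rewrite ?inE ?size_r // sort_sorted.
Qed.

(** Through the sorted enumeration [e], [flip] becomes the involution [s] of the positions, and [a]
    reads first coordinates. *)
Lemma cmat_surj : exists2 sa : 'S_n * lab,
  (sa.1 \in involutions n) && compat sa.1 sa.2 & A = cmat sa.1 sa.2.
Proof.
have [e [e_inj e_surj e_in e_mono]] := cell_seq.
have flipK : involutive flip by move=> [[i j] c].
have flip_in x : x \in cells -> flip x \in cells.
  by case: x => [[i j] c]; rewrite !inE /flip /= (symmatP _ symA).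
pose f p := odflt p [pick q | e q == flip (e p)].
have fP p : e (f p) = flip (e p).
  rewrite /f; case: pickP => [q /eqP // | no].
  by have [q eq] := e_surj _ (flip_in _ (e_in p)); have := no q;
    rewrite eq eqxx.
have fK : involutive f by move=> p; apply: e_inj; rewrite !fP flipK.
pose s : 'S_n := perm (can_inj fK).
pose a : lab := [ffun p => (e p).1.1].
have aE p : a p = (e p).1.1 by rewrite ffunE.
have asE p : a (s p) = (e p).1.2 by rewrite ffunE permE fP.
exists (s, a) => /=.
  apply/andP; split; first by apply/involutionsP=> p; rewrite !permE fK.
  apply/forallP=> p; apply/forallP=> q; apply/implyP=> /eqP eq_q.
  have lt_pq : p < q by rewrite eq_q.
  have := e_mono _ _ lt_pq; rewrite !aE.
  case: ltnP => [lt_s | _]; last by rewrite /cle; lia.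
  (* At a descent, equal first coordinates would force [e p = e q]: [flip] reverses the order of the
     two cells while keeping their copy numbers. *)
  have := e_mono _ _ lt_s; rewrite !permE !fP /cle /flip /=.
  have : e p != e q by rewrite (inj_eq e_inj) -(inj_eq val_inj) neq_ltn lt_pq.
  case: (e p) (e q) => [[i j] c] [[i' j'] c'].
  by rewrite !xpair_eqE -!(inj_eq val_inj) /=; lia.
apply/ffunP=> -[i j]; apply: val_inj; rewrite /= cmatE -cells_fiber.
rewrite -(card_imset _ e_inj); apply: eq_card => x; rewrite !inE.
apply/andP/imsetP => [[xA xij] | [p + ->]].
  have [p Ep] := e_surj x (etrans (in_set _ _) xA).
  exists p => //; rewrite inE aE asE Ep; move: xij.
  by case: (x) => [[i' j'] c]; rewrite xpair_eqE.
rewrite inE aE asE => Eij; split; first by have := e_in p; rewrite inE.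
by move: Eij; case: (e p) => [[i' j'] c]; rewrite xpair_eqE.
Qed.

End Sorting.

Lemma card_symmat_involutions :
  #|[set A : mat | symmat A & \sum_ij A ij == n]| =
  \sum_(s in involutions n) #|[set a | compat s a]|.
Proof.
pose B := [set sa : 'S_n * lab | (sa.1 \in involutions n) && compat sa.1 sa.2].
transitivity #|B|.
  rewrite -(card_in_imset (f := fun sa => cmat sa.1 sa.2) (D := B)).
    apply: eq_card => A; rewrite inE; apply/andP/imsetP.
      by case=> symA /eqP sumA; have [sa saB ->] := cmat_surj symA sumA;
        exists sa; rewrite // [_ \in B]inE.
    by case=> -[s a]; rewrite [_ \in B]inE => /andP[/= Is _] ->;
      rewrite cmat_sym ?cmat_sum.
  move=> [s a] [s' a']; rewrite ![_ \in B]inE =>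
    /andP[/= Is sa] /andP[/= Is' sa'].
  exact: cmat_inj.
rewrite -sum1_card; under [RHS]eq_bigr do rewrite -sum1_card.
by rewrite pair_big_dep; apply: eq_bigl => -[s a]; rewrite !inE.
Qed.

End LabelledInvolutions.

(** * Labellings compatible with a permutation *)

Section CountLabels.
Variables (m k : nat) (s : 'S_m.+1).
Let n := m.+1.

Notation lab := {ffun 'I_n -> 'I_k}.
Implicit Types (a : lab) (p q : 'I_n).

Definition dsc (i : nat) : bool := (i < m) && (s (inord i.+1) < s (inord i)).

(* Adding [rise p] to the label of p turns the labellings compatible with s
   into the strictly increasing sequences. *)
Definition rise (i : nat) : nat := \sum_(j < i) ~~ dsc j.

Lemma riseS i : rise i.+1 = rise i + ~~ dsc i.
Proof. by rewrite /rise big_ord_recr. Qed.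

Lemma descentsE : descents s = \sum_(i < m) dsc i.
Proof.
transitivity (\sum_(i < n) dsc i); last first.
  by rewrite big_ord_recr /= {2}/dsc ltnn addn0.
rewrite /descents -sum1_card big_mkcond; apply: eq_bigr => i _;
  rewrite inE /dsc.
case: existsP => [[j /andP[/eqP eq_j lt_s]] | no].
  have lt_im : i < m by have := ltn_ord j; lia.
  by rewrite lt_im -eq_j !inord_val lt_s.
case: (ltnP i m) => //= lt_im; rewrite inord_val.
case lt_s: (_ < _) => //; case: no; exists (inord i.+1).
by rewrite inordK ?eqxx.
Qed.

Lemma rise_descents : rise m + descents s = m.
Proof.
rewrite descentsE /rise -big_split /= -[RHS]card_ord -sum1_card.
by apply: eq_bigr => i _; case: dsc.
Qed.

Lemma rise_le i : rise i <= i.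
Proof.
rewrite -[X in _ <= X]card_ord -sum1_card; apply: leq_sum => j _.
by case: dsc.
Qed.

Lemma compat_dsc a : compat s a <->
  forall p q, q = p.+1 :> nat -> a p + dsc p <= a q.
Proof.
have dscE p q : q = p.+1 :> nat -> dsc p = (s q < s p).
  move=> eq_q; rewrite /dsc -eq_q !inord_val.
  by rewrite -ltnS ltn_ord.
split=> [/forallP sa p q eq_q | sa].
  by rewrite (dscE p q) //; move/forallP/(_ q)/implyP: (sa p); apply; apply/eqP.
apply/forallP=> p; apply/forallP=> q; apply/implyP=> /eqP eq_q.
by rewrite -(dscE p q) // sa.
Qed.

(** The shifted labels [a p + rise p] are the strictly increasing sequences below [M]: the last one
    is at most [k - 1 + rise m], and [rise m = m - descents s]. *)
Lemma card_compat : #|[set a : lab | compat s a]| = 'C(m - descents s + k, n).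
Proof.
set M := m - descents s + k; have riseM : rise m = m - descents s.
  by have := rise_descents; lia.
rewrite -(card_ltn_sorted_tuples n M).
have rise_mono i j : i <= j -> rise i <= rise j.
  elim: j => [|j IHj]; first by rewrite leqn0 => /eqP->.
  by rewrite leq_eqVlt => /predU1P[-> // | /IHj]; rewrite riseS; lia.
have lt_shift a p : a p + rise p < M.
  by have := rise_mono p m; rewrite -ltnS ltn_ord => /(_ isT);
    have := ltn_ord (a p); rewrite /M; lia.
pose shift a : n.-tuple 'I_M := [tuple Ordinal (lt_shift a p) | p < n].
have shiftE a p : tnth (shift a) p =
  a p + rise p :> nat by rewrite tnth_mktuple.
have shift_inj : injective shift.
  move=> a a' eq_t; apply/ffunP=> p; apply: val_inj; apply: (@addIn (rise p)).
  by rewrite /= -!shiftE eq_t.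
rewrite -(card_imset _ shift_inj); apply: eq_card => t; rewrite [in RHS]inE.
have sortedP : reflect (forall p q, q = p.+1 :> nat -> tnth t p < tnth t q)
    (sorted ltn (map val t)).
  have x0 := tnth t ord0.
  apply: (iffP (sortedP 0)) => [st p q eq_q | st i].
    have := st p; rewrite size_map size_tuple -eq_q ltn_ord => /(_ isT).
    by rewrite !(nth_map x0) ?size_tuple // -!tnth_nth.
  rewrite size_map size_tuple => lt_i; have lt_i' : i < n by apply: ltnW.
  rewrite !(nth_map x0) ?size_tuple //.
  by have := st (Ordinal lt_i') (Ordinal lt_i) erefl; rewrite !(tnth_nth x0).
apply/imsetP/sortedP => [[a + ->] p q eq_q | st].
  rewrite inE compat_dsc => sa; rewrite !shiftE eq_q riseS.
  by have := sa p q eq_q; case: dsc; lia.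
(* With [rise p <= p], this keeps the subtraction [tnth t p - rise p] from being truncated. *)
have ge_t p : p <= tnth t p.
  case: p => i; elim: i => // i IHi lt_i; have lt_i' : i < n by apply: ltnW.
  have := st (Ordinal lt_i') (Ordinal lt_i) erefl.
  by have := IHi lt_i'; move=> /=; lia.
have mono_t p q : p <= q -> tnth t p - rise p <= tnth t q - rise q.
  case: q => j; elim: j => [|j IHj] lt_j /=.
    by rewrite leqn0 => /eqP p0; have -> : p = Ordinal lt_j by apply: val_inj.
  have lt_j' : j < n by apply: ltnW.
  rewrite leq_eqVlt => /predU1P[eq_p | /(IHj lt_j')].
    by have -> : p = Ordinal lt_j by apply: val_inj.
  move/leq_trans; apply; have := st (Ordinal lt_j') (Ordinal lt_j) erefl.
  by rewrite riseS /=; case: dsc; lia.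
(* By monotonicity the last position suffices, where [M - rise m = k]. *)
have lt_k p : tnth t p - rise p < k.
  have := mono_t p ord_max; rewrite -ltnS ltn_ord => /(_ isT) /=.
  have := ltn_ord (tnth t ord_max); have := ge_t ord_max; have := rise_le m.
  have : M = rise m + k by rewrite riseM.
  by move=> /=; lia.
exists [ffun p => Ordinal (lt_k p)].
  rewrite inE; apply/compat_dsc => p q eq_q; rewrite !ffunE /= eq_q riseS.
  have aux (x y z r : nat) (b : bool) :
      r <= z -> z <= x -> x < y -> x - r + b <= y - (r + ~~ b) by case: b; lia.
  exact: aux (rise_le p) (ge_t p) (st p q eq_q).
apply: eq_from_tnth => p; apply: val_inj; rewrite /= shiftE ffunE /=.
by rewrite subnK // (leq_trans (rise_le p)).
Qed.

End CountLabels.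

(** * Power series in the alphabet size *)

Local Open Scope ring_scope.

(** Pascal's rule: one factor [1 - X] lowers [n] by one, down to the geometric series. *)
Lemma bin_fps_inv N n :
  eqt N ((1 - 'X) ^+ n.+1 * trunc N (fun m => 'C(n + m, n))) 1.
Proof.
elim: n => [|n IHn].
  move=> i iN; rewrite expr1 -['X]expr1.
  rewrite (@trunc_diff N _ (fun m => (m == 0)%N : nat)) //.
    by rewrite coef_poly ltnS iN coef1.
  by case=> [|m] _ //=; rewrite !bin0.
move=> i iN; rewrite exprSr -mulrA -(IHn i iN).
apply: eqtM (iN) => // j jN; rewrite -['X]expr1; apply: trunc_diff (jN) => m _.
case: m => [|m] /=; first by rewrite !addn0 !binn.
by rewrite subn1 /= addSn binS addSnnS.
Qed.

(** Both series are inverse to [(1 - X)^(n+1)], of constant term 1. In the two convolutions the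
    earlier coefficients agree by induction, so the last ones do. *)
Lemma fps_inv_bin n m :
  fps_inv (fps_of_poly ((1 - 'X) ^+ n.+1 : {poly int})) m = ('C(n + m, n))%:R.
Proof.
set g := fps_of_poly _.
have g0 : g 0%N = 1.
  by rewrite /g /fps_of_poly -horner_coef0 horner_exp !hornerE expr1n.
elim/ltn_ind: m => m IHm.
have gU : g 0%N \is a GRing.unit by rewrite g0 unitr1.
have := fps_mulfV gU m; rewrite [fps_of_poly 1 m](esym (bin_fps_inv n (leqnn
  m))).
rewrite coefM /fps_mul.
rewrite !big_ord_recl /= subn0 -/(g 0%N) -[X in X * _]/(g 0%N) g0 !mul1r.
rewrite coef_poly ltnS leqnn.
move/eqP; rewrite [X in _ + X == _](eq_bigr (fun i : 'I_m =>
  ((1 - 'X) ^+ n.+1)`_(bump 0 i) * (trunc m (fun m =>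
    'C(n + m, n)))`_(m - bump 0 i))).
  by rewrite (inj_eq (addIr _)) -[X in X * _]/(g 0%N) g0 mul1r => /eqP.
move=> i _; rewrite IHm ?coef_poly ?ifT //.
  by rewrite ltnS leq_subr.
by rewrite /bump /=; have := ltn_ord i; lia.
Qed.

Lemma a_sum_binomial m k : a_ m.+1 k =
  (\sum_(s in involutions m.+1) 'C(m - descents s + k, m.+1))%N.
Proof.
(* The width [m.+1 + k] accommodates both the number of columns and the number of steps. *)
rewrite /a_ /= (@num_ssyt_chains (m.+1 + k)) ?leq_addr //.
rewrite card_chains ?leq_addl // card_symmat_involutions.
by apply: eq_bigr => s _; exact: card_compat.
Qed.

Lemma num_ssyt0 k : num_ssyt 0 k = 1%N.
Proof.
rewrite (@num_ssyt_chains k) // card_chains //.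
apply: (eq_card1 (x := [ffun=> ord0])) => A; rewrite !inE;
  apply/idP/eqP => [_ | ->].
  by apply/ffunP=> ij; rewrite ffunE; apply/val_inj; case: (A ij) => -[].
rewrite big1 ?andbT // => [|ij _]; last by rewrite ffunE.
by apply/symmatP=> i j; rewrite !ffunE.
Qed.

Theorem theorem5 (n : nat) :
  (fun k : nat => (a_ n k)%:R : int)
    =1 fps_div (fps_of_poly ('X * I_poly n)) (fps_of_poly ((1 - 'X) ^+ n.+1)).
Proof.
move=> k; rewrite /fps_div /fps_mul.
under eq_bigr do rewrite fps_inv_bin.
rewrite /fps_of_poly big_ord_recl coefXM mul0r add0r.
under eq_bigr => i _ do rewrite coefXM coef_sum big_distrl /=.
rewrite exchange_big /=.
(* Only [i = descents s] contributes; [bump 0 i] is [i + 1], from the factor [X]. *)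
have inner (s : 'S_n) : \sum_(i < k) 'X^(descents s)`_i * 'C(n + (k - bump 0
  i), n)%:R
   = (if (descents s < k)%N then 'C(n + (k - (descents s).+1),
     n) else 0%N)%:R :> int.
  case: ltnP => [lt_dk | le_kd].
    rewrite (bigD1 (Ordinal lt_dk)) //= coefXn eqxx mul1r big1 ?addr0 // => i.
    by rewrite coefXn -(inj_eq val_inj) /= => /negPf->; rewrite mul0r.
  rewrite big1 // => i _; rewrite coefXn [_ == _](_ : _ = false) ?mul0r //.
  by apply/eqP; have := ltn_ord i; lia.
under eq_bigr do rewrite inner.
rewrite -natr_sum; congr (_ %:R); case: n {inner} => [|m].
  (* For [n = 0] the only permutation has no descent, so the sum is 1 for [k > 0] and 0 for [k = 0],
     in agreement with [a_ 0 0 = 0]. *)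
  have I0 (s : 'S_0) : s \in involutions 0 by apply/involutionsP; case.
  rewrite (eq_bigl xpredT) // (eq_bigr (fun=> (0 < k)%N : nat)); last first.
    move=> s _; rewrite [descents s](_ : _ = 0%N) ?bin0; first by case: ltnP.
    by apply/eqP; rewrite cards_eq0; apply/eqP/setP; case.
  rewrite sum_nat_const cardT -cardE card_Sn mul1n /a_ num_ssyt0.
  by case: k.
rewrite a_sum_binomial; apply: eq_bigr => s _; have := rise_descents s.
(* Write d for [descents s], so d <= m. If d >= k, then m - d + k <= m and the binomial vanishes;
   otherwise m + 1 + (k - (d + 1)) = m - d + k. *)
case: ltnP => [lt_dk | le_kd] eq_m; last by rewrite bin_small //; lia.
by congr 'C(_, _); lia.
Qed.
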